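(* Let $I$ be a non-empty set and let $\langle \kappa_i : i\in I\rangle$ be a sequence of non-zero cardinals. Then $\langle \kappa_i : i\in I\rangle$ is reversible if and only if one of the following holds: (1) $\langle \kappa_i : i\in I\rangle$ is finite-to-one, i.e. for every cardinal $\kappa$ the set $\{i\in I:\kappa_i=\kappa\}$ is finite; or (2) $\kappa_i\in\mathbb{N}$ for all $i\in I$, the set $K:=\{m\in\mathbb{N} : |\{i\in I:\kappa_i=m\}|\geq\omega\}$ is non-empty and independent, and $\gcd(K)$ divides at most finitely many elements of the set $\{\kappa_i : i\in I\}$.
   Context: $\mathbb{N}=\{1,2,3,\dots\}$. A sequence of non-zero cardinals $\langle \kappa_i : i\in I\rangle$ (with $I\neq\emptyset$) is called reversible iff there is no non-injective surjection $f:I\to I$ such that $\kappa_j=\sum_{i\in f^{-1}[\{j\}]}\kappa_i$ for all $j\in I$ (equivalently, every surjection $f:I\to I$ satisfying this condition is a bijection). For $K\subseteq\mathbb{N}$, $\langle K\rangle$ denotes the subsemigroup of $\langle\mathbb{N},+\rangle$ generated by $K$ (the set of all finite sums, with at least one summand, of elements of $K$). $K$ is independent iff for every $n\in K$, $n\notin\langle K\setminus\{n\}\rangle$. *)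

(* Defs.v *)
From mathcomp Require Import all_boot.
From mathcomp Require Import boolp classical_sets functions cardinality.

Set Implicit Arguments.
Unset Strict Implicit.
Unset Printing Implicit Defensive.

Local Open Scope classical_set_scope.
Local Open Scope card_scope.

(* A cardinal is represented by a type having that cardinality; equality of
   cardinals is then equipotence [#=]. The alias makes "for every cardinal"
   range over the same universe as the terms of a sequence of cardinals. *)
Definition cardinal := Type.

Definition same_card (A B : cardinal) : Prop := [set: A] #= [set: B].

Definition has_card (A : cardinal) (m : nat) : Prop := [set: A] #= `I_m.

(* The fiber sum is the disjoint union of the [kappa i] for [f i = j]. *)
Definition sum_preserving (I : Type) (kappa : I -> cardinal) (f : I -> I) :
    Prop :=
  forall j : I,
    [set: kappa j] #=
    [set x : {i : I & kappa i} | (f @^-1` [set j]) (projT1 x)].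

Definition reversible (I : Type) (kappa : I -> cardinal) : Prop :=
  ~ exists f : I -> I,
      [/\ set_surj [set: I] [set: I] f, ~ injective f
        & sum_preserving kappa f].

Definition finite_to_one (I : Type) (kappa : I -> cardinal) : Prop :=
  forall C : cardinal, finite_set [set i | same_card (kappa i) C].

Definition subsemigroup (S : set nat) : Prop :=
  forall m n, S m -> S n -> S (m + n).

Definition generated (K : set nat) : set nat := smallest subsemigroup K.

Definition independent (K : set nat) : Prop :=
  forall n, K n -> ~ generated (K `\ n) n.

Definition is_gcd (K : set nat) (d : nat) : Prop :=
  (forall k, K k -> d %| k) /\
  (forall e, (forall k, K k -> e %| k) -> e %| d).

Definition gcd_set (K : set nat) : nat := xget 0 (is_gcd K).

Lemma gcd_setP (K : set nat) : is_gcd K (gcd_set K).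
Proof.
suff [d Kd] : exists d, is_gcd K d by exact: (xgetPex 0 (ex_intro _ d Kd)).
have [[k [Kk k_gt0]]|K0] := pselect (exists k, K k /\ 0 < k); last first.
  exists 0; split=> // k Kk; have [->//|k_gt0] := posnP k.
  by case: K0; exists k.
pose P (d : nat) := `[< forall m, K m -> d %| m >].
exists (\big[lcmn/1]_(d < k.+1 | P d) d); split=> [m Km|e eK].
  by apply/dvdn_biglcmP => d /asboolP/(_ m Km).
have lt_ek : e < k.+1 by rewrite ltnS dvdn_leq ?eK.
by apply: (biglcmn_sup (Ordinal lt_ek)) => //; apply/asboolP.
Qed.

Definition repeated_values (I : Type) (kappa : I -> cardinal) : set nat :=
  [set m | 0 < m /\ infinite_set [set i | has_card (kappa i) m]].

(* Main.v *)
From HB Require Import structures.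
Require Import Defs.
From mathcomp Require Import all_boot.
From mathcomp Require Import boolp classical_sets functions cardinality.

(* Let f be a surjection over which the cardinals sum up; then f never lowers a
   cardinal. If the sequence is finite-to-one, a least cardinal that f raises
   would have a finite level set contained in its own image, hence permuted by
   f, which is absurd; so f permutes every (finite) level set.
   For finite cardinals with repeated values K, an induction shows that every
   value raised by f lies in <K>. By independence nothing is raised to a value
   in K, so the values reached from below are non-repeated multiples of gcd K;
   the largest one yields a contradiction.
   Conversely, if some cardinal is repeated infinitely often and some larger or
   equal term is infinite, it absorbs one copy of the repeated cardinal while
   the others are shifted. Otherwise a failure of (2) gives a sequence j_t of
   indices such that the value at j_0 and the increments of the values are sums
   of repeated values; sending j_t to j_{t+1} and filling the gaps by elements
   of infinite level sets is a non-injective surjection. *)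

Local Open Scope classical_set_scope.
Local Open Scope card_scope.

(** * Arithmetic of infinite cardinals *)

Lemma card_le_set_inj {T U : Type} (A : set T) (B : set U) (f : T -> U) :
  set_fun A B f -> set_inj A f -> A #<= B.
Proof.
move=> fAB finj; rewrite -(card_le_eql (inj_card_eq finj)).
by apply: subset_card_le => _ [x Ax <-]; exact: fAB.
Qed.

Lemma card_eq_set_bij {T U : Type} (A : set T) (B : set U) (f : T -> U) :
  set_bij A B f -> A #= B.
Proof.
move=> [fAB finj fsurj]; rewrite card_eq_sym -(card_eqr (inj_card_eq finj)).
have -> // : f @` A = B.
by apply/seteqP; split=> [_ [x Ax <-]|//]; exact: fAB.
Qed.

Lemma card_le_ex_inj {T U : Type} (A : set T) (B : set U) (u0 : U) :
  A #<= B -> exists f : T -> U, set_fun A B f /\ set_inj A f.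
Proof.
(* [pcard_leP] asks for a pointed codomain; [u0] provides the point. *)
pose U' := HB.pack_for pointedType U (gen_eqMixin U) (gen_choiceMixin U)
  (isPointed.Build U u0).
move=> AB; have /pcard_leP[f] : A #<= (B : set U') by exact: AB.
by exists f; split; [exact: funS|exact: inj].
Qed.

Lemma card_eq_ex_bij {T U : Type} (A : set T) (B : set U) (u0 : U) :
  A #= B -> exists f : T -> U, set_bij A B f.
Proof.
pose U' := HB.pack_for pointedType U (gen_eqMixin U) (gen_choiceMixin U)
  (isPointed.Build U u0).
by move=> AB; have /card_set_bijP : A #= (B : set U') by exact: AB.
Qed.

Lemma infinite_set_seq {T : Type} (A : set T) :
  infinite_set A -> exists f : nat -> T, (forall k, A (f k)) /\ injective f.
Proof.
move=> Ainf; have [x Ax] := infinite_setN0 Ainf.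
have /(card_le_ex_inj _ _ x)[f [fA finj]] := (infiniteP A).1 Ainf.
exists f; split=> [k|a b]; first exact: fA.
by apply: finj; rewrite inE.
Qed.

Lemma card_setU_le {T U : Type} (A B : set T) (A' B' : set U) :
  A' `&` B' = set0 -> A #<= A' -> B #<= B' -> A `|` B #<= A' `|` B'.
Proof.
move=> dis AA BB; have [[u0 _]|U0] := pselect (exists u : U, True); last first.
  have e (X : set U) : X = set0.
    by apply/seteqP; split=> // u _; apply: U0; exists u.
  move: AA BB; rewrite (e A') (e B') !card_le0 => /eqP-> /eqP->.
  by rewrite !setU0 card_ge0.
have [f [fA fi]] := card_le_ex_inj _ _ u0 AA.
have [g [gB gi]] := card_le_ex_inj _ _ u0 BB.
have no x y : A x -> B y -> f x <> g y.
  move=> Ax By e; have : (A' `&` B') (f x) by split; [exact: fA|rewrite e; exact: gB].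
  by rewrite dis.
apply: (@card_le_set_inj _ _ _ _ (fun x => if `[< A x >] then f x else g x)).
  move=> x; case: asboolP => [Ax _|nA [//|Bx]]; first by left; exact: fA.
  by right; exact: gB.
move=> x y; rewrite !inE; case: asboolP => [Ax _|nAx [//|Bx]];
  case: asboolP => [Ay _|nAy [//|By]] e.
- by apply: fi => //; rewrite inE.
- by case: (no _ _ Ax By).
- by case: (no _ _ Ay Bx).
- by apply: gi => //; rewrite inE.
Qed.

Lemma card_setU_eq {T U : Type} (A B : set T) (A' B' : set U) :
  A `&` B = set0 -> A' `&` B' = set0 -> A #= A' -> B #= B' ->
  A `|` B #= A' `|` B'.
Proof.
move=> d d' AA BB; rewrite card_eq_le !card_setU_le //.
- by move: AA; rewrite card_eq_le => /andP[].
- by move: BB; rewrite card_eq_le => /andP[].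
- by move: AA; rewrite card_eq_le => /andP[].
- by move: BB; rewrite card_eq_le => /andP[].
Qed.

(** Hilbert's hotel: a sequence [g] in [A] is moved to its even places, and the points of [B]
    outside [A] go to the odd ones. *)
Lemma card_setU_countable {T : Type} (A B : set T) :
  infinite_set A -> countable B -> A `|` B #<= A.
Proof.
move=> Ainf Bc; have [g [gA ginj]] := infinite_set_seq _ Ainf.
have [c [_ ci]] := card_le_ex_inj B setT 0 Bc.
have [k kE] : exists k : T -> nat, forall m, k (g m) = m.
  have /choice[k kP] (x : T) : exists m, (exists m', x = g m') -> x = g m.
    by have [[m e]|ne] := pselect (exists m, x = g m); [exists m|exists 0].
  by exists k => m; apply: ginj; rewrite -kP //; exists m.
pose h x := if `[< A x >] then if x == g (k x) :> {classic T} then g (k x).*2 else x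
            else g (c x).*2.+1.
apply: (@card_le_set_inj _ _ _ _ h) => [x _|x y].
  by rewrite /h; case: asboolP => // Ax; case: eqP.
rewrite !inE /h; case: asboolP => [Ax _|nAx [//|Bx]];
  case: asboolP => [Ay _|nAy [//|By]].
- case: eqP => ex; case: eqP => ey.
  + by move/ginj/double_inj => e; rewrite ex ey e.
  + by move=> e; case: ey; rewrite -e kE.
  + by move=> e; case: ex; rewrite e kE.
  + by [].
- case: eqP => ex.
    by move/ginj => e; have := congr1 odd e; rewrite /= !odd_double.
  by move=> e; case: ex; rewrite e kE.
- case: eqP => ey.
    by move/ginj => e; have := congr1 odd e; rewrite /= !odd_double.
  by move=> e; case: ey; rewrite -e kE.
- by move/ginj => -[/double_inj e]; apply: ci; rewrite ?inE.
Qed.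

(* Zorn's lemma applied to graphs G of partial maps on A whose range contains
   dom G * bool. The domain of a maximal G is cofinite in A: a sequence g
   outside of it could be added by g (2 m + b) |-> (g m, b). *)
Lemma card_setX_bool {T : Type} (A : set T) :
  infinite_set A -> A `*` [set: bool] #<= A.
Proof.
move=> Ainf.
pose dom (G : set (T * (T * bool))) := [set x | exists p, G (x, p)].
pose P (G : set (T * (T * bool))) :=
  [/\ dom G `<=` A,
      forall x p q, G (x, p) -> G (x, q) -> p = q
    & forall x b, dom G x -> exists z, G (z, (x, b))].
have [F FP Ftot|G [[GA Gf Gd] Gmax]] := @Zorn_bigcup _ P.
  split=> [x [p [X FX Xxp]]|x p q [X FX Xxp] [Y FY Yxq]|x b [p [X FX Xxp]]].
  - by have [XA _ _] := FP _ FX; apply: XA; exists p.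
  - have [XY|YX] := Ftot _ _ FX FY.
      by have [_ Yf _] := FP _ FY; apply: Yf Yxq; exact: XY.
    by have [_ Xf _] := FP _ FX; apply: Xf Xxp _; exact: YX.
  - have [_ _ Xd] := FP _ FX; have [|z Xz] := Xd x b; first by exists p.
    by exists z, X.
have fin : finite_set (A `\` dom G).
  apply: contrapT => /infinite_set_seq[g [gA ginj]].
  pose N := [set t | exists m, t = (g m, (g m./2, odd m))].
  apply: (Gmax (G `|` N)).
    split; last first.
      move=> /(_ (g 0, (g 0, false))) H.
      have [_] := gA 0; apply; exists (g 0, false); apply: H.
      by right; exists 0.
    by move=> t; left.
  split=> [x [p [Gx|[m [-> _]]]]|x p q [Gp|[m [-> ->]]]|x b].
  - by apply: GA; exists p.
  - by have [] := gA m.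
  - case=> [|[m [e _]]]; first exact: Gf.
    by have [_] := gA m; case; rewrite -e; exists p.
  - case=> [Gq|[m' [/ginj <- ->]]] //.
    by have [_] := gA m; case; exists q.
  - move=> [p [Gp|[m [-> _]]]].
      by have [|z Gz] := Gd x b; [exists p|exists z; left].
    exists (g (b + m.*2)); right; exists (b + m.*2).
    by rewrite half_bit_double oddD odd_double; case: b.
have domE : A = dom G `|` (A `\` dom G) by rewrite setDUK.
have dinf : infinite_set (dom G).
  by move=> df; apply: Ainf; rewrite domE finite_setU.
have [x0 _] := infinite_setN0 Ainf.
have AG : A #<= dom G.
  rewrite [X in X #<= _]domE; apply: card_setU_countable => //.
  exact: finite_set_countable.
have [h [hG hi]] := card_le_ex_inj _ _ x0 AG.
(* [r] chooses preimages under [G]; it is injective over [dom G] because [G] is single-valued. *)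
have /choice[r rP] (t : T * bool) : exists z, dom G t.1 -> G (z, t).
  have [/(Gd _ t.2)[z Gz]|n] := pselect (dom G t.1); last by exists x0.
  by exists z => _; rewrite -surjective_pairing in Gz.
apply: (@card_le_set_inj _ _ _ _ (fun t => r (h t.1, t.2))).
  by move=> [x b] [/= Ax _]; apply: GA; exists (h x, b); apply: rP; exact: hG.
move=> [x b] [y c]; rewrite !inE /= => -[/= Ax _] [/= Ay _] e.
have := rP (h x, b) (hG _ Ax); rewrite e => /Gf/(_ (rP (h y, c) (hG _ Ay))).
by case=> e1 ->; congr (_, _); apply: hi e1; rewrite inE.
Qed.

(** The union embeds into the product of [A] with [bool]: points of [A] are tagged [false], the
    others are sent into [A] and tagged [true]. *)
Lemma card_setU_absorb {T : Type} (A B : set T) :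
  infinite_set A -> B #<= A -> A `|` B #= A.
Proof.
move=> Ainf BA; rewrite card_eq_le; apply/andP; split; last first.
  by apply: subset_card_le => x; left.
have [x0 _] := infinite_setN0 Ainf.
have [h [hA hi]] := card_le_ex_inj _ _ x0 BA.
apply: card_le_trans (card_setX_bool _ Ainf).
apply: (@card_le_set_inj _ _ _ _
  (fun x => if `[< A x >] then (x, false) else (h x, true))).
  by move=> x; case: asboolP => [//|nA [//|Bx]]; split=> //=; exact: hA.
move=> x y; rewrite !inE; case: asboolP => [Ax _|nAx [//|Bx]];
  case: asboolP => [Ay _|nAy [//|By]] [] //.
by apply: hi; rewrite inE.
Qed.

(* A maximal set of choice functions that is coordinatewise injective
   exhausts some coordinate, which is therefore a least cardinal. *)
Lemma card_least {J : Type} (kappa : J -> Type) :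
  (exists j : J, True) ->
  exists j, forall i, [set: kappa j] #<= [set: kappa i].
Proof.
move=> [j0 _].
pose P (S : set (forall j, kappa j)) :=
  forall u v j, S u -> S v -> u j = v j -> u = v.
have [F FP Ftot|S [SP Smax]] := @Zorn_bigcup _ P.
  move=> u v j [X FX Xu] [Y FY Yv].
  have [XY|YX] := Ftot _ _ FX FY.
    by apply: (FP _ FY) => //; exact: XY.
  by apply: (FP _ FX) => //; exact: YX.
have [j jsurj] : exists j, forall a, exists2 u, S u & u j = a.
  apply: contrapT => no.
  (* If every coordinate misses a value, the missed values form a [u] that could be added to [S]. *)
  have /cid[u uP] : exists u : (forall j, kappa j), forall j v, S v -> v j <> u j.
    have H j : exists a, forall v, S v -> v j <> a.
      apply: contrapT => n; apply: no; exists j => a; apply: contrapT => na.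
      by apply: n; exists a => v Sv e; apply: na; exists v.
    by exists (fun j => projT1 (cid (H j))) => j; exact: (projT2 (cid (H j))).
  apply: (Smax (S `|` [set u])).
    split=> [|H]; first by move=> v; left.
    have Su : S u by apply: H; right.
    by case: (uP j0 u Su).
  move=> v w j [Sv|->] [Sw|->] //.
  - exact: SP.
  - by move/(uP _ _ Sv).
  - by move/esym/(uP _ _ Sw).
have /choice[r rP] a : exists u, S u /\ u j = a.
  by have [u Su e] := jsurj a; exists u.
exists j => i; apply: (@card_le_set_inj _ _ _ _ (fun a => r a i)) => // a b _ _ e.
have [Sa <-] := rP a; have [Sb <-] := rP b.
by rewrite (SP _ _ _ Sa Sb e).
Qed.

(** * Sums over fibers *)

(** All partial sums live in one sigma type, so that unions of index sets become unions of sets by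
    computation. *)
Definition total_over {I : Type} (kappa : I -> cardinal) (D : set I) :
  set {i : I & kappa i} := [set x | D (projT1 x)].

(** Proof irrelevance turns the equality of first projections into [erefl], which removes the
    transport between the second ones. *)
Lemma existT_inj {I : Type} {kappa : I -> Type} {i : I} :
  injective (existT kappa i).
Proof.
by move=> a b e; have := projT2_eq e; rewrite (Prop_irrelevance (projT1_eq e) erefl).
Qed.

Lemma total_over_set1 {I : Type} (kappa : I -> cardinal) (i : I) :
  total_over kappa [set i] #= [set: kappa i].
Proof.
rewrite card_eq_sym; apply: (@card_eq_set_bij _ _ _ _ (existT kappa i)).
split=> //; first by move=> a b _ _; exact: existT_inj.
by move=> [i' a] /= e; rewrite /total_over /= in e; subst i'; exists a.
Qed.

Lemma total_overU {I : Type} (kappa : I -> cardinal) (D E : set I) :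
  total_over kappa (D `|` E) = total_over kappa D `|` total_over kappa E.
Proof. by []. Qed.

Lemma card_II_add (a b : nat) : `I_(a + b) `\` `I_a #= `I_b.
Proof. by have := @card_IID (a + b) a; rewrite addKn. Qed.

Lemma total_over_seq {I : choiceType} (kappa : I -> cardinal) (n : I -> nat)
    (s : seq I) :
  (forall i, has_card (kappa i) (n i)) -> uniq s ->
  total_over kappa [set` s] #= `I_(\sum_(i <- s) n i).
Proof.
move=> nP; elim: s => [_|i s IH /= /andP[nis us]].
  by rewrite big_nil II0 set_nil card_eq0; apply/eqP/seteqP; split.
have -> : [set` i :: s] = [set i] `|` [set` s].
  apply/seteqP; split=> x /=; rewrite inE.
    by case/orP=> [/eqP|]; [left|right].
  by case=> [->|->]; rewrite ?eqxx ?orbT.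
rewrite big_cons total_overU.
have -> : `I_(n i + \sum_(j <- s) n j) =
    `I_(n i) `|` (`I_(n i + \sum_(j <- s) n j) `\` `I_(n i)).
  by rewrite setDUK // => k /= /leq_trans; apply; exact: leq_addr.
apply: card_setU_eq.
- by apply/seteqP; split=> // -[j x] [/= e]; rewrite /total_over /= in e *;
    rewrite e (negPf nis).
- by rewrite setDIK.
- exact: card_eq_trans (total_over_set1 _ _) (nP i).
- apply: card_eq_trans (IH us) _; rewrite card_eq_sym; exact: card_II_add.
Qed.

(** The numeric form of [sum_preserving]; listing each fiber also makes it finite. *)
Definition fiber_sums {I : choiceType} (n : I -> nat) (f : I -> I) : Prop :=
  forall j, exists s : seq I,
    [/\ uniq s, forall i, (i \in s) = (f i == j) & n j = \sum_(i <- s) n i].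

Lemma sum_preserving_fiber_sums {I : choiceType} (kappa : I -> cardinal)
    (n : I -> nat) (f : I -> I) :
  (forall i, has_card (kappa i) (n i)) -> (forall i, 0 < n i) ->
  sum_preserving kappa f <-> fiber_sums n f.
Proof.
move=> nP npos.
have setE (s : seq I) j : (forall i, (i \in s) = (f i == j)) ->
    [set x : {i & kappa i} | (f @^-1` [set j]) (projT1 x)]
      = total_over kappa [set` s].
  move=> sP; apply/seteqP; split=> -[i x]; rewrite /total_over /= sP.
    by move=> ->.
  by move/eqP.
split=> H j.
  have fin : finite_set (f @^-1` [set j]).
    have : finite_set (total_over kappa (f @^-1` [set j])).
      rewrite -(eq_finite_set (H j)) (eq_finite_set (nP j)); exact: finite_II.
    move=> tfin; apply: contrapT => /infinite_set_seq[g [gf ginj]].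
    (* All terms are non-empty, so an infinite fiber would embed [nat] into a finite sum. *)
    have x0 i : {x : kappa i | True}.
      apply: cid; apply: contrapT => no.
      have e : [set: kappa i] = set0.
        by apply/seteqP; split=> // x _; case: no; exists x.
      have := nP i; rewrite /has_card e card_eq_sym card_eq0 => /eqP e'.
      by have : `I_(n i) 0 := npos i; rewrite e'.
    move: tfin; apply/infiniteP.
    apply: (@card_le_set_inj _ _ _ _ (fun k => existT kappa (g k) (sval (x0 (g k))))).
      by move=> k _; exact: gf.
    by move=> a b _ _ /(congr1 (@projT1 _ _)) /= /ginj.
  have [s0 s0E] := (finite_seqP _).1 fin.
  have sP i : (i \in undup s0) = (f i == j).
    rewrite mem_undup; have : [set` s0] i = (f i = j) by rewrite -s0E.
    by move=> /= E; apply/idP/eqP; rewrite E.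
  exists (undup s0); split=> //; first exact: undup_uniq.
  apply/card_eq_II; rewrite -(card_eql (nP j)) (card_eql (H j)) (setE _ _ sP).
  exact: total_over_seq (undup_uniq _).
have [s [us sP e]] := H j; rewrite (setE _ _ sP).
apply: card_eq_trans (nP j) _; rewrite e card_eq_sym.
exact: total_over_seq.
Qed.

(** The image of a duplicate-free list of [A] has the same length and contains [A], so it is a
    rearrangement of that list. *)
Lemma finite_set_surj_perm {I : choiceType} (A : set I) (f : I -> I) :
  finite_set A -> A `<=` f @` A -> set_fun A A f /\ set_inj A f.
Proof.
move=> /finite_seqP[s0 A0]; rewrite A0 => sub; pose s := undup s0.
have sP i : (i \in s) = (i \in s0) by rewrite mem_undup.
have us : uniq s := undup_uniq _.
have ss : {subset s <= map f s}.
  move=> i; rewrite sP => /sub[i' i's <-]; apply: map_f; by rewrite sP.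
have sz : size (map f s) <= size s by rewrite size_map.
have um := leq_size_uniq us ss sz.
have [_ me] := uniq_min_size us ss sz.
split=> [i /= is0|i i']; first by rewrite -sP me map_f // sP.
rewrite !inE /= -!sP => i1 i2 e.
have l1 : index i s < size s by rewrite index_mem.
have l2 : index i' s < size s by rewrite index_mem.
rewrite -(nth_index i i1) -(nth_index i i2); congr nth.
apply/eqP; rewrite -(nth_uniq (f i) _ _ um) ?size_map //.
by rewrite !(nth_map i) // !nth_index // e.
Qed.

Lemma finite_set_inj_perm {I : choiceType} (A : set I) (f : I -> I) :
  finite_set A -> set_fun A A f -> set_inj A f -> A `<=` f @` A.
Proof.
move=> /finite_seqP[s0 A0]; rewrite A0 => sub fi; pose s := undup s0.
have sP i : (i \in s) = (i \in s0) by rewrite mem_undup.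
have us : uniq (map f s).
  rewrite map_inj_in_uniq ?undup_uniq // => a b; rewrite !sP => sa sb.
  by apply: fi; rewrite inE.
have ss : {subset map f s <= s}.
  by move=> x /mapP[i]; rewrite !sP => is0 ->; apply: sub.
have sz : size s <= size (map f s) by rewrite size_map.
have [_ me] := uniq_min_size us ss sz.
move=> i /=; rewrite -sP -me => /mapP[i' i's ->]; exists i' => //=.
by rewrite -sP.
Qed.

(** * Generated subsemigroups *)

Lemma generated_sub (K : set nat) : K `<=` generated K.
Proof. exact: sub_gen_smallest. Qed.

Lemma generated_add (K : set nat) : subsemigroup (generated K).
Proof. by move=> m n Km Kn A AK; apply: AK.1; [exact: Km|exact: Kn]. Qed.

Lemma generated_sum (K : set nat) (I : eqType) (s : seq I) (n : I -> nat) :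
  s != [::] -> {in s, forall i, generated K (n i)} ->
  generated K (\sum_(i <- s) n i).
Proof.
elim: s => // i [|i' s] IH _ H; first by rewrite big_seq1; apply: H; rewrite mem_head.
rewrite big_cons; apply: generated_add; first by apply: H; rewrite mem_head.
by apply: IH => // a ai; apply: H; rewrite inE ai orbT.
Qed.

Lemma generated_seq (K : set nat) (m : nat) :
  generated K m -> exists s : seq nat,
    [/\ s != [::], {in s, forall k, K k} & sumn s = m].
Proof.
move: m; apply: smallest_sub => [m n [s [s0 sK <-]] [t [_ tK <-]]|k Kk].
  exists (s ++ t); split; rewrite ?sumn_cat //; first by case: s s0 {sK}.
  by move=> k; rewrite mem_cat => /orP[/sK|/tK].
by exists [:: k]; split; rewrite /= ?addn0 // => k'; rewrite inE => /eqP->.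
Qed.

Lemma generated_dvdn (K : set nat) (d m : nat) :
  (forall k, K k -> d %| k) -> generated K m -> d %| m.
Proof.
by move=> Kd; move: m; apply: smallest_sub => // m n; exact: dvdn_add.
Qed.

(** A summand never exceeds the sum, so [c] cannot occur in a sum below [c]. *)
Lemma generated_lt (K : set nat) (c m : nat) :
  generated K m -> m < c -> generated (K `\ c) m.
Proof.
move: m; apply: (@smallest_sub _ _ _ [set m | m < c -> generated (K `\ c) m]).
  move=> m n /= Km Kn lt.
  by apply: generated_add; [apply: Km|apply: Kn]; apply: leq_ltn_trans lt;
     rewrite ?leq_addr ?leq_addl.
move=> k Kk lt; apply: generated_sub; split=> //= e.
by rewrite e ltnn in lt.
Qed.

(** * Finite cardinals: the condition (2) is sufficient *)

Section NumericReversible.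
Context {I : choiceType} (n : I -> nat) (f : I -> I).
Hypothesis npos : forall i, 0 < n i.
Hypothesis fsurj : forall j, exists i, f i = j.
Hypothesis fsum : fiber_sums n f.

Lemma fiber_le (i : I) : n i <= n (f i).
Proof.
have [s [us sP ->]] := fsum (f i).
by rewrite (big_rem i) ?sP ?eqxx // leq_addr.
Qed.

(** The term [n i] already exhausts the sum over its fiber, and any further term would be
    positive. *)
Lemma fiber_eq_inj (i i' : I) : n (f i) = n i -> f i' = f i -> i' = i.
Proof.
move=> e fe; have [s [us sP]] := fsum (f i).
rewrite (big_rem i) ?sP ?eqxx //= e => /eqP.
rewrite -[X in X == _]addn0 eqn_add2l eq_sym => /eqP s0.
apply/eqP; apply: contraT => ne.
have ir : i' \in rem i s by rewrite rem_filter // mem_filter /= ne sP fe eqxx.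
by move: s0; rewrite (big_rem i') //=; have := npos i'; case: (n i').
Qed.

Lemma fiber_generated (K : set nat) (j : I) :
  (forall i, f i = j -> generated K (n i)) -> generated K (n j).
Proof.
move=> H; have [s [us sP ->]] := fsum j; apply: generated_sum.
  have [i fi] := fsurj j; have : i \in s by rewrite sP fi.
  by case: (s).
by move=> i; rewrite sP => /eqP; exact: H.
Qed.

Let K := [set m | infinite_set [set i | n i = m]].

(* If n i is not a repeated value, then its level set is finite and f raises
   an element of it, so that some j in it is hit only from strictly below. *)
Lemma raised_generated (i : I) : n i < n (f i) -> generated K (n i).
Proof.
have [m] := ubnP (n i); elim: m i => // m IH i; rewrite ltnS => lem lt.
have [/generated_sub//|nK] := pselect (K (n i)).
have fin : finite_set [set j | n j = n i] by exact: contrapT.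
have [sub|/existsNP[j /not_implyP[/= nj no]]] :=
    pselect ([set j | n j = n i] `<=` f @` [set j | n j = n i]).
  have [/(_ i erefl) /= e _] := finite_set_surj_perm _ _ fin sub.
  by rewrite e ltnn in lt.
rewrite -nj; apply: fiber_generated => i' fi'.
have lt' : n i' < n (f i').
  rewrite ltn_neqAle fiber_le andbT fi'; apply/eqP => e.
  by apply: no; exists i' => //=; rewrite e.
by apply: IH (lt'); apply: leq_trans lem; rewrite -nj -fi'.
Qed.

(** If [i] were raised, its whole fiber would be raised, since a point keeping its value is alone in
    its fiber. Then [n (f i)] would be a sum of smaller elements of [K]. *)
Lemma independent_not_raised (i : I) :
  independent K -> K (n (f i)) -> n (f i) = n i.
Proof.
move=> ind Kf; apply: contrapT => ne.
apply: (ind _ Kf); apply: fiber_generated => i' e.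
have lt : n i' < n (f i).
  rewrite -e ltn_neqAle fiber_le andbT; apply/eqP => e'.
  by have := fiber_eq_inj _ _ (esym e') (esym e) => ii; apply: ne; rewrite ii.
by apply: generated_lt (lt); apply: raised_generated; rewrite e.
Qed.

(* A value that f reaches from below is a multiple of d and is not repeated,
   so there is a largest one m. Then f permutes the finite level set of m,
   which leaves no room for a second point in a fiber over it. *)
Lemma numeric_reversible (d : nat) :
  independent K -> (forall k, K k -> d %| k) ->
  finite_set [set m | (exists i, n i = m) /\ d %| m] -> injective f.
Proof.
move=> ind dK fin.
suff H i : n (f i) = n i by move=> i i'; exact: (fiber_eq_inj i' i (H i')).
apply: contrapT => /eqP ne.
pose B := [set m | exists i, n i < m /\ n (f i) = m].
have Bd m : B m -> d %| m.
  move=> [i1 [lt1 e1]]; rewrite -e1; apply: generated_dvdn (dK) _.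
  apply: fiber_generated => i2 e2; apply: raised_generated.
  rewrite ltn_neqAle fiber_le andbT; apply/eqP => e.
  have ii := fiber_eq_inj _ _ (esym e) (esym e2).
  by move: lt1; rewrite ii -e1 -e2 -e ltnn.
have [m Bm mmax] : exists2 m, B m & forall m', B m' -> m' <= m.
  have [s sE] := (finite_seqP _).1 fin.
  have Bs m : B m -> m <= \max_(k <- s) k.
    move=> Bm; apply: leq_bigmax_seq => //.
    suff : [set` s] m by [].
    by rewrite -sE; split; [case: Bm => i1 [_ <-]; exists (f i1)|exact: Bd].
  have exB : exists m, `[< B m >].
    exists (n (f i)); apply/asboolP; exists i; split=> //.
    by rewrite ltn_neqAle fiber_le eq_sym ne.
  have [m /asboolP Bm mx] := @ex_maxnP (fun m => `[< B m >]) _ exB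
    (fun m Bm => Bs m (asboolW Bm)).
  by exists m => // m' Bm'; apply: mx; apply/asboolP.
have [i1 [lt1 e1]] := Bm.
have nK : ~ K m.
  by rewrite -e1 => /(independent_not_raised _ ind) e; move: lt1; rewrite -e1 e ltnn.
have mfin : finite_set [set i | n i = m] by exact: contrapT.
(* A point of value [m] is not raised, since its image would have a larger value in [B]. *)
have fm : set_fun [set i | n i = m] [set i | n i = m] f.
  move=> i2 /= e2; apply/eqP; rewrite eqn_leq -{2}e2 fiber_le andbT.
  have := fiber_le i2; rewrite leq_eqVlt => /orP[/eqP <-|lt]; first by rewrite e2.
  by apply: mmax; exists i2; split=> //; rewrite -e2.
have finj : set_inj [set i | n i = m] f.
  move=> i2 i3; rewrite !inE /= => e2 e3 e.
  by apply: fiber_eq_inj e; rewrite e3; exact: fm.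
have [|i2 /= e2 e] := finite_set_inj_perm _ _ mfin fm finj (f i1); first exact: e1.
have ii : i1 = i2 by apply: fiber_eq_inj; rewrite e // e2.
by move: lt1; rewrite ii e2 ltnn.
Qed.

End NumericReversible.

(** * Constructions of non-injective surjections *)

(** Unlike [generated], this allows the empty sum 0. *)
Definition sums (K : set nat) : set nat :=
  [set m | exists2 s : seq nat, {in s, forall k, K k} & sumn s = m].

Lemma sums_add (K : set nat) (a b : nat) : sums K a -> sums K b -> sums K (a + b).
Proof.
move=> [s sK <-] [t tK <-]; exists (s ++ t); last by rewrite sumn_cat.
by move=> k; rewrite mem_cat => /orP[/sK|/tK].
Qed.

Lemma sums_mul (K : set nat) (q a : nat) : sums K a -> sums K (q * a).
Proof.
move=> Ka; elim: q => [|q IH]; first by exists [::].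
by rewrite mulSn; exact: sums_add.
Qed.

Lemma sums_dvdn (K : set nat) (d m : nat) :
  (forall k, K k -> d %| k) -> sums K m -> d %| m.
Proof.
move=> dK [s sK <-]; rewrite sumnE big_seq; apply: dvdn_sum => k ks.
by apply: dK; exact: sK.
Qed.

(** Bezout without subtraction: the least positive difference [g] of two sums divides each element
    of [K], since a non-zero remainder modulo [g] would be a smaller such difference. *)
Lemma is_gcd_sums_diff (K : set nat) (d k : nat) : is_gcd K d -> K k -> 0 < k ->
  exists b, sums K b /\ sums K (b + d).
Proof.
move=> [dK dmax] Kk k0.
have K1 a : K a -> sums K a.
  move=> Ka; exists [:: a]; last by rewrite /= addn0.
  by move=> x; rewrite inE => /eqP->.
pose P g := `[< 0 < g /\ exists b, sums K b /\ sums K (b + g) >].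
have exP : exists g, P g.
  exists k; apply/asboolP; split=> //; exists 0; split; first by exists [::].
  exact: K1.
have [g /asboolP[g0 [b [Kb Kbg]]] gmin] := ex_minnP exP.
suff -> : d = g by exists b.
apply/eqP; rewrite eqn_dvd; apply/andP; split.
  by rewrite -(dvdn_addr _ (sums_dvdn _ _ _ dK Kb)) (sums_dvdn _ _ _ dK Kbg).
apply: dmax => a Ka; apply: contraT => nd.
have : g <= a %% g.
  apply: gmin; apply/asboolP; rewrite lt0n; split=> //.
  (* Adding [a %% g] to this sum gives the sum [a + a %/ g * b]. *)
  exists (a %/ g * (b + g)); split; first exact: sums_mul.
  have -> : a %/ g * (b + g) + a %% g = a + a %/ g * b.
    by rewrite mulnDr -addnA -divn_eq addnC.
  by apply: sums_add; [exact: K1|exact: sums_mul].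
by rewrite leqNgt ltn_pmod.
Qed.

(** With [b = c * d] and [c > 0], the multiple [q * d] consists of [q %% c] copies of [b + d] and
    [q %/ c - q %% c] copies of [b], which makes sense once [c * c <= q]. If [c = 0], then [d]
    itself is a sum. *)
Lemma is_gcd_large_sums (K : set nat) (d k : nat) : is_gcd K d -> K k -> 0 < k ->
  exists N, forall m, N <= m -> d %| m -> sums K m.
Proof.
move=> gK Kk k0; have [b [Kb Kbd]] := is_gcd_sums_diff _ _ _ gK Kk k0.
have [dK _] := gK.
have d0 : 0 < d by apply: dvdn_gt0 (k0) (dK _ Kk).
have /dvdnP[c bE] := sums_dvdn _ _ _ dK Kb.
exists (c * c * d) => m + /dvdnP[q mE]; rewrite mE leq_pmul2r // => cq.
have [c0|cpos] := posnP c.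
  by apply: sums_mul; move: Kbd; rewrite bE c0 mul0n add0n.
have le : q %% c <= q %/ c.
  by apply: leq_trans (ltnW (ltn_pmod _ cpos)) _; rewrite leq_divRL.
have -> : q * d = (q %/ c - q %% c) * b + q %% c * (b + d).
  by rewrite mulnDr addnA -mulnDl subnK // bE mulnA -mulnDl -divn_eq.
by apply: sums_add; exact: sums_mul.
Qed.

(* Each weight class of Z in which elements of V have to be inserted is
   infinite, hence absorbs them. *)
Lemma weighted_absorb {I T : Type} (n : I -> nat) (w : T -> nat)
    (Z : set I) (V : set T) :
  countable V ->
  (forall v, V v -> infinite_set [set i | Z i /\ n i = w v]) ->
  exists phi : I -> T + I,
    set_bij Z (inl @` V `|` inr @` Z) phi /\
    forall i, Z i -> (match phi i with inl v => w v | inr i' => n i' end) = n i.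
Proof.
move=> Vc Zinf.
pose Zk k := [set i | Z i /\ n i = k].
pose Wk k : set (T + I) := inr @` Zk k `|` inl @` [set v | V v /\ w v = k].
have inrE A : (@inr T I) @` A #= A by apply: inj_card_eq => a b _ _ [].
have /choice[theta thP] k : exists th : I -> T + I, set_bij (Zk k) (Wk k) th.
  have [[v [Vv wv]]|no] := pselect (exists v, V v /\ w v = k).
    apply: card_eq_ex_bij; first exact: inl v.
    have inf : infinite_set (Zk k) by rewrite -wv; exact: Zinf.
    rewrite card_eq_sym -(card_eqr (inrE (Zk k))).
    apply: card_setU_absorb; first by rewrite (eq_finite_set (inrE _)).
    apply: (@card_le_trans _ _ _ [set: nat]).
      apply: card_le_trans (card_image_le _ _) _; apply: sub_countable Vc.
      by apply: subset_card_le => u [].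
    by rewrite (card_le_eqr (inrE _)); apply/infiniteP.
  exists inr; split=> [i Zi|a b _ _ [] //|u [[i Zi <-]|[v Vv _]]].
  - by left; exists i.
  - by exists i.
  - by case: no; exists v.
exists (fun i => theta (n i) i); split; first split.
- move=> i Zi; have [/(_ i (conj Zi erefl)) + _ _] := thP (n i).
  by case=> [[i' [Zi' _] <-]|[v [Vv _] <-]]; [right; exists i'|left; exists v].
(* [phi] keeps weights, so points with equal images lie in one class, where [theta] is injective. *)
- have wt i : Z i ->
    (match theta (n i) i with inl v => w v | inr i' => n i' end) = n i.
    move=> Zi; have [/(_ i (conj Zi erefl)) + _ _] := thP (n i).
    by case=> [[i' [_ e] <-]|[v [_ e] <-]].
  move=> a b; rewrite !inE => Za Zb e.
  have nab : n a = n b by rewrite -(wt a Za) -(wt b Zb) e.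
  have [_ inj _] := thP (n b); apply: inj; rewrite ?inE //.
  by rewrite -e nab.
- have surj u k : Wk k u -> exists2 i, Z i & theta (n i) i = u.
    move=> Wu; have [_ _ /(_ u Wu) [i [Zi ni] <-]] := thP k.
    by exists i => //; rewrite ni.
  move=> _ [[v Vv <-]|[i Zi <-]].
    by apply: (surj _ (w v)); right; exists v.
  by apply: (surj _ (n i)); left; exists i.
- move=> i Zi; have [/(_ i (conj Zi erefl)) + _ _] := thP (n i).
  by case=> [[i' [_ e] <-]|[v [_ e] <-]].
Qed.

(* The map sends j_t to j_{t+1}; the missing weight L_t of each j_t is supplied
   by elements outside the sequence, whose weight classes are infinite. *)
Lemma shift_not_reversible {I : choiceType} (n : I -> nat) (j : nat -> I)
    (L : nat -> seq nat) :
  injective j ->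
  (forall t k, k \in L t -> infinite_set [set i | (~` range j) i /\ n i = k]) ->
  n (j 0) = sumn (L 0) ->
  (forall t, n (j t.+1) = n (j t) + sumn (L t.+1)) ->
  1 < size (L 0) ->
  exists f : I -> I,
    [/\ forall i, exists i', f i' = i, ~ injective f & fiber_sums n f].
Proof.
move=> jinj Linf n0 nS L0.
(* A slot [(t, p)] stands for the entry of index [p] in [L t], to be filled by an element of [Z] of
   that weight. *)
pose V := [set v : nat * nat | v.2 < size (L v.1)].
pose w (v : nat * nat) := nth 0 (L v.1) v.2.
pose Z := ~` range j.
have [//|v Vv|phi [[phiV phi_inj phi_surj] phiw]] := @weighted_absorb _ _ n w Z V.
  by apply: Linf; exact: mem_nth.
have /choice[psi psiP] (u : nat * nat + I) :
    exists i, (inl @` V `|` inr @` Z) u -> Z i /\ phi i = u.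
  have [/phi_surj[i Zi <-]|no] := pselect ((inl @` V `|` inr @` Z) u).
    by exists i.
  by exists (j 0).
have psiV t p : p < size (L t) ->
    Z (psi (inl (t, p))) /\ phi (psi (inl (t, p))) = inl (t, p).
  by move=> lt; apply: psiP; left; exists (t, p).
have psiZ z : Z z -> Z (psi (inr z)) /\ phi (psi (inr z)) = inr z.
  by move=> Zz; apply: psiP; right; exists z.
have /choice[idx idxP] i : exists t, ~ Z i -> i = j t.
  have [Zi|/contrapT[t _ <-]] := pselect (Z i); first by exists 0.
  by exists t.
have idxE t : idx (j t) = t.
  by apply: jinj; rewrite -idxP // => nr; apply: nr; exists t.
pose f i := if `[< Z i >] then
              (match phi i with inl v => j v.1 | inr i' => i' end)
            else j (idx i).+1.
have nZ t : ~ Z (j t) by move=> nr; apply: nr; exists t.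
have fj t : f (j t) = j t.+1.
  by rewrite /f; case: asboolP => [/nZ//|_]; rewrite idxE.
have fV t p : p < size (L t) -> f (psi (inl (t, p))) = j t.
  by move=> /psiV[Zp e]; rewrite /f; case: asboolP => // _; rewrite e.
have fZ z : Z z -> f (psi (inr z)) = z.
  by move=> /psiZ[Zp e]; rewrite /f; case: asboolP => // _; rewrite e.
have fP i : [\/ exists t, i = j t /\ f i = j t.+1,
      exists t p, [/\ p < size (L t), i = psi (inl (t, p)) & f i = j t]
    | exists z, [/\ Z z, i = psi (inr z) & f i = z] ].
  have [Zi|nZi] := pselect (Z i); last first.
    by constructor 1; exists (idx i); rewrite -fj -idxP.
  have := phiV i Zi; case=> [[[t p] Vt e]|[z Zz e]].
    constructor 2; exists t, p.
    have [Zp pe] := psiV _ _ Vt.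
    have ei : i = psi (inl (t, p)) by apply: phi_inj; rewrite ?inE // pe.
    by split=> //; rewrite ei fV.
  constructor 3; exists z; have [Zp pe] := psiZ _ Zz.
  have ei : i = psi (inr z) by apply: phi_inj; rewrite ?inE // pe.
  by split=> //; rewrite ei fZ.
exists f; split.
- move=> i; have [Zi|/idxP ->] := pselect (Z i).
    by exists (psi (inr i)); exact: fZ.
  case: (idx i) => [|t]; last by exists (j t).
  by exists (psi (inl (0, 0))); apply: fV; exact: ltnW.
(* [L 0] has two slots, and their distinct fillers both go to [j 0]. *)
- move=> finj; have := finj (psi (inl (0, 0))) (psi (inl (0, 1))).
  rewrite !fV // ?(ltnW L0) // => /(_ erefl) e.
  have [_] := psiV 0 0 (ltnW L0); rewrite e.
  by have [_ ->] := psiV 0 1 L0.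
- have sumL t : \sum_(i <- [seq psi (inl (t, p)) | p <- iota 0 (size (L t))]) n i
      = sumn (L t).
    rewrite big_map sumnE [RHS](big_nth 0) /index_iota subn0 big_seq [RHS]big_seq.
    apply: eq_bigr => p; rewrite mem_iota => /andP[_ lt].
    by have [Zp e] := psiV _ _ lt; rewrite -(phiw _ Zp) e.
  have uL t : uniq [seq psi (inl (t, p)) | p <- iota 0 (size (L t))].
    rewrite map_inj_in_uniq ?iota_uniq // => p q; rewrite !mem_iota.
    move=> /andP[_ ltp] /andP[_ ltq] e; have [_] := psiV _ _ ltp.
    by rewrite e; have [_ ->] := psiV _ _ ltq; case.
  have memL t i : i \in [seq psi (inl (t, p)) | p <- iota 0 (size (L t))] <->
      Z i /\ f i = j t.
    split=> [/mapP[p]|[Zi fi]].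
      rewrite mem_iota => /andP[_ lt] ->; split; last exact: fV.
      by have [] := psiV _ _ lt.
    have [[t' [e _]]|[t' [p [lt e e']]]|[z [Zz _ e]]] := fP i.
    + by case: (nZ t'); rewrite -e.
    + have tt : t' = t by apply: jinj; rewrite -e'.
      by rewrite -tt e map_f // mem_iota.
    + by case: (nZ t); rewrite -fi e.
  move=> i; have [Zi|/idxP ->] := pselect (Z i).
    exists [:: psi (inr i)]; split=> //; last first.
      by have [Zp e] := psiZ _ Zi; rewrite big_seq1 -(phiw _ Zp) e.
    move=> i'; rewrite inE; apply/eqP/eqP => [->|e]; first exact: fZ.
    have [[t [_ e']]|[t [p [_ _ e']]]|[z [_ i'E e']]] := fP i'.
    + by case: (nZ t.+1); rewrite -e' e.
    + by case: (nZ t); rewrite -e' e.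
    + by rewrite i'E -e e'.
  case: (idx i) => [|t].
    exists [seq psi (inl (0, p)) | p <- iota 0 (size (L 0))].
    split; rewrite ?sumL // => i'; apply/idP/eqP => [/memL[]//|e].
    apply/memL; split=> //; apply: contrapT => /idxP i'E.
    by have := fj (idx i'); rewrite -i'E e => /jinj.
  (* The fiber over [j t.+1] is [j t] together with the fillers of [L t.+1]. *)
  exists (j t :: [seq psi (inl (t.+1, p)) | p <- iota 0 (size (L t.+1))]).
  split; rewrite ?big_cons ?sumL //=.
    by rewrite uL andbT; apply/negP => /memL[/nZ].
  move=> i'; rewrite inE; apply/orP/eqP => [[/eqP->//|/memL[]//]|e].
  have [Zi'|/idxP i'E] := pselect (Z i'); first by right; apply/memL.
  left; apply/eqP; have := fj (idx i'); rewrite -i'E e => /jinj[->].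
  by [].
Qed.

(** Terms [g m] of cardinality [C] are shifted down by one, [g 0] goes to [i0], and all else is
    fixed. Only the fiber over [i0] has two points, and there [kappa i0] absorbs [C]. *)
Lemma infinite_not_reversible {I : choiceType} (kappa : I -> cardinal)
    (i0 : I) (C : cardinal) :
  infinite_set [set: kappa i0] -> [set: C] #<= [set: kappa i0] ->
  infinite_set [set i | same_card (kappa i) C] ->
  exists f : I -> I,
    [/\ forall i, exists i', f i' = i, ~ injective f & sum_preserving kappa f].
Proof.
move=> inf0 C0 infC.
(* [i0] may itself have cardinality [C], so it is kept out of [g]. *)
have /infinite_set_seq[g [gC ginj]] :
    infinite_set ([set i | same_card (kappa i) C] `\ i0).
  by apply: infinite_setD => //; exact: finite_set1.
have /choice[k kP] i : exists m, range g i -> i = g m.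
  have [[m _ <-]|no] := pselect (range g i); first by exists m.
  by exists 0.
have kE m : k (g m) = m by apply: ginj; rewrite -kP //; exists m.
pose f i := if i == g (k i) then (if k i is m.+1 then g m else i0) else i.
have fg0 : f (g 0) = i0 by rewrite /f kE eqxx.
have fgS m : f (g m.+1) = g m by rewrite /f kE eqxx.
have fn i : ~ range g i -> f i = i.
  by move=> no; rewrite /f; case: eqP => // e; case: no; exists (k i).
have gi0 m : g m <> i0 by have [] := gC m.
have ngi0 : ~ range g i0 by move=> [m _ /gi0].
have fi0 : f i0 = i0 by exact: fn.
exists f; split.
- move=> i; have [[m _ <-]|/fn e] := pselect (range g i); last by exists i.
  by exists (g m.+1).
- by move=> finj; apply: (gi0 0); apply: finj; rewrite fg0.
move=> i.
have [->|ne] := eqVneq i i0.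
  have -> : [set x : {i & kappa i} | (f @^-1` [set i0]) (projT1 x)] =
      total_over kappa ([set i0] `|` [set g 0]).
    apply/seteqP; split=> -[i' x]; rewrite /total_over /=; last by case=> ->.
    have [[[|m] _ <-]|/fn->] := pselect (range g i'); [by right| |by left].
    by rewrite fgS => /gi0.
  rewrite total_overU card_eq_sym.
  rewrite -(card_eqr (total_over_set1 kappa i0)).
  apply: card_setU_absorb.
    by rewrite (eq_finite_set (total_over_set1 _ _)).
  rewrite (card_le_eql (total_over_set1 _ _)) (card_le_eqr (total_over_set1 _ _)).
  by have [gC0 _] := gC 0; rewrite (card_le_eql gC0).
have [i1 i1P e1] : exists2 i1, (forall i', f i' = i <-> i' = i1) &
    [set: kappa i] #= [set: kappa i1].
  have [[m _ <-]|no] := pselect (range g i).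
    exists (g m.+1); last first.
      have [a _] := gC m; have [b _] := gC m.+1.
      by rewrite (card_eql a) card_eq_sym.
    move=> i'; split=> [|->]; last exact: fgS.
    have [[[|m'] _ <-]|no] := pselect (range g i').
    + by rewrite fg0 => /esym/gi0.
    + by rewrite fgS => /ginj ->.
    + by rewrite fn // => e; case: no; exists m.
  exists i => // i'; split=> [|->]; last exact: fn.
  have [[[|m] _ <-]|no'] := pselect (range g i').
  - by rewrite fg0 => e; rewrite e eqxx in ne.
  - by rewrite fgS => e; case: no; exists m.
  - by rewrite fn.
have -> : [set x : {i & kappa i} | (f @^-1` [set i]) (projT1 x)] =
    total_over kappa [set i1].
  by apply/seteqP; split=> -[i' x]; rewrite /total_over /= => /i1P.
by rewrite (card_eql e1) card_eq_sym; exact: total_over_set1.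
Qed.

(** * The characterization *)

Lemma sum_preserving_le {I : Type} (kappa : I -> cardinal) (f : I -> I) (i : I) :
  sum_preserving kappa f -> [set: kappa i] #<= [set: kappa (f i)].
Proof.
move=> fsum; rewrite (card_le_eqr (fsum (f i))).
apply: (@card_le_set_inj _ _ _ _ (existT kappa i)) => // a b _ _.
exact: existT_inj.
Qed.

Lemma finite_to_one_injective {I : choiceType} (kappa : I -> cardinal)
    (f : I -> I) :
  finite_to_one kappa -> (forall j, exists i, f i = j) ->
  sum_preserving kappa f -> injective f.
Proof.
move=> fin fsurj fsum.
have H i : same_card (kappa (f i)) (kappa i).
  apply: contrapT => ni.
  pose J := {i : I | ~ same_card (kappa (f i)) (kappa i)}.
  have [[j nj] jmin] := @card_least J (fun a => kappa (sval a))
    (ex_intro _ (exist _ i ni) Logic.I).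
  have fc := fin (kappa j).
  have [sub|/existsNP[l /not_implyP[/= lj no]]] :=
     pselect ([set i | same_card (kappa i) (kappa j)] `<=`
        f @` [set i | same_card (kappa i) (kappa j)]).
    have [fA _] := finite_set_surj_perm _ _ fc sub.
    by apply: (nj); apply: fA; exact: card_eqxx.
  have [i' fi'] := fsurj l.
  have i'l : [set: kappa i'] #<= [set: kappa j].
    by rewrite -(card_le_eqr lj) -fi'; exact: sum_preserving_le _ _ _ fsum.
  have ni' : ~ same_card (kappa i') (kappa j).
    by move=> s; apply: no; exists i'.
  (* [f] also changes the cardinal at [i'], so minimality of [j] bounds [kappa i'] from below. *)
  apply: ni'; rewrite /same_card card_eq_le i'l /=.
  apply: (jmin (exist _ i' _)) => s; apply: no; exists i' => //=.
  by rewrite /same_card -(card_eql s) fi'; exact: lj.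
move=> i i' e.
(* Since [f] keeps cardinals, it permutes each level set, and [i] and [i'] share one. *)
have [|_ finj] := finite_set_surj_perm _ f (fin (kappa i)).
  move=> l /= li; have [l' fl'] := fsurj l; exists l' => //=.
  by rewrite /same_card -(card_eql (H l')) fl'.
apply: finj => //; rewrite inE /= /same_card; first exact: card_eqxx.
by rewrite -(card_eql (H i')) -e; exact: H.
Qed.

(** * Finite cardinals: the condition (2) is necessary *)

Section FiniteCardinals.
Context {I : choiceType} (kappa : I -> cardinal) (n : I -> nat).
Hypothesis nP : forall i, has_card (kappa i) (n i).
Hypothesis npos : forall i, 0 < n i.

Lemma has_cardE (i : I) (m : nat) : has_card (kappa i) m <-> n i = m.
Proof.
split=> [im|<-//]; apply/card_eq_II.
by rewrite -(card_eql (nP i)); exact: im.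
Qed.

Lemma repeated_valuesE :
  repeated_values kappa = [set m | infinite_set [set i | n i = m]].
Proof.
have E m : [set i | has_card (kappa i) m] = [set i | n i = m].
  by apply/seteqP; split=> i /=; rewrite has_cardE.
rewrite /repeated_values; apply/seteqP; split=> m /=; rewrite E; first by case.
by move=> inf; split=> //; have [i <-] := infinite_setN0 inf.
Qed.

(** If [c] is a sum of other repeated values, the shift applies to a sequence of terms all equal to
    [c]: that sum fills [j 0], and every increment is 0. *)
Lemma reversible_independent :
  reversible kappa -> independent (repeated_values kappa).
Proof.
move=> rev c; rewrite repeated_valuesE => Kc /generated_seq[s [s0 sK sE]].
have [j [jc jinj]] := infinite_set_seq _ Kc; rewrite /= in jc.
(* A single summand would be [c] itself, which is excluded. *)
have s1 : 1 < size s.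
  case: s s0 sK sE => // a [|//] _ /(_ a (mem_head _ _)) [_ ac].
  by rewrite /= addn0 => e; case: ac.
apply: rev.
have [|t k||t||f [fs fi fsum]] :=
    @shift_not_reversible _ n j (fun t => if t is 0 then s else [::]).
- exact: jinj.
- case: t => [|//] /sK[Kk kc]; apply: contra_not Kk => fin.
  apply: sub_finite_set fin => i /= ni; split=> // -[t _ e].
  by apply: kc; rewrite /= -ni -e jc.
- by rewrite jc sE.
- by rewrite !jc addn0.
- exact: s1.
exists f; split=> //; first by move=> i _; have [i' e] := fs i; exists i'.
exact/(sum_preserving_fiber_sums _ _ _ nP npos).
Qed.

(* All large multiples of the gcd are sums of repeated values, so a sequence j
   of terms divisible by the gcd can be chosen with increments n j_{t+1} - n j_t
   that are sums of repeated values. *)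
Lemma reversible_gcd :
  reversible kappa -> repeated_values kappa !=set0 ->
  finite_set [set m | (exists i, has_card (kappa i) m) /\
                      gcd_set (repeated_values kappa) %| m].
Proof.
move=> rev [k Kk]; set K := repeated_values kappa in Kk *.
apply: contrapT => inf; apply: rev.
have gK : is_gcd K (gcd_set K) := gcd_setP K.
have [dK _] := gK; have [k0 _] := Kk.
have [N NP] := is_gcd_large_sums _ _ _ gK Kk k0.
have /choice[F FP] M : exists i, M < n i /\ gcd_set K %| n i.
  apply: contrapT => no; apply: inf.
  apply: (sub_finite_set _ (finite_II M.+1)) => m [[i /has_cardE <-] dn] /=.
  by rewrite ltnS leqNgt; apply/negP => lt; apply: no; exists i.
(* The margin [N] makes every increment a sum; starting above [N + k] lets [k] be split off from
   [n (j 0)]. *)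
pose j := fix j t := if t is t'.+1 then F (n (j t') + N) else F (N + k).
have dj t : gcd_set K %| n (j t) by case: t => [|t]; exact: (FP _).2.
have jS t : n (j t) + N < n (j t.+1) by exact: (FP _).1.
have jlt : {homo (n \o j) : t u / t < u}.
  by apply: homo_ltn ltn_trans _ => t; apply: leq_ltn_trans (jS t); exact: leq_addr.
have njinj : injective (n \o j) by apply: incn_inj; apply: leq_mono.
have jinj : injective j by move=> t u e; apply: njinj; rewrite /= e.
have j0 : N + k < n (j 0) by exact: (FP _).1.
have kj : k <= n (j 0) := leq_trans (leq_addl N k) (ltnW j0).
have [s0 s0K s0E] : sums K (n (j 0) - k).
  apply: NP; last exact: dvdn_sub (dj 0) (dK k Kk).
  by rewrite leq_subRL // addnC; exact: ltnW.
have /choice[L LP] t : exists s : seq nat,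
    {in s, forall k, K k} /\ sumn s = n (j t.+1) - n (j t).
  have [|s sK sE] := NP (n (j t.+1) - n (j t)) _ (dvdn_sub (dj _) (dj _)).
    rewrite leq_subRL; first exact: ltnW.
    by apply: leq_trans (ltnW (jS t)); exact: leq_addr.
  by exists s.
have [|t m||t||f [fs fi fsum]] :=
    @shift_not_reversible _ n j (fun t => if t is t'.+1 then L t' else k :: s0).
- exact: jinj.
- move=> mL; have : K m.
    case: t mL => [|t]; last exact: (LP t).1.
    by rewrite inE => /orP[/eqP->|/s0K].
  rewrite /K repeated_valuesE /= => Im.
  (* Values increase along [j], so removing its range takes at most one point from a level set. *)
  have one : finite_set [set i | range j i /\ n i = m].
    have [[t0 e0]|no] := pselect (exists t0, n (j t0) = m).
      apply: (sub_finite_set _ (finite_set1 (j t0))) => i [[t1 _ <-] e1] /=.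
      by congr j; apply: njinj; rewrite /= e1 e0.
    apply: (sub_finite_set _ (@finite_set0 I)) => i [[t1 _ <-] e1].
    by apply: no; exists t1.
  apply: (contra_not _ (infinite_setD Im one)) => fin.
  apply: sub_finite_set fin => i [/= ni no]; split=> // r; exact: no.
- by rewrite /= s0E subnKC.
- rewrite (LP t).2 subnKC //; apply: leq_trans (ltnW (jS t)); exact: leq_addr.
(* [n (j 0)] exceeds [k], so [s0] is non-empty and [k :: s0] has two entries. *)
- rewrite /= ltnS lt0n size_eq0; apply/eqP => s0n.
  move: s0E; rewrite s0n /= => /eqP; rewrite eq_sym subn_eq0 leqNgt.
  by rewrite (leq_ltn_trans _ j0) ?leq_addl.
exists f; split=> //; first by move=> i _; have [i' e] := fs i; exists i'.
exact/(sum_preserving_fiber_sums _ _ _ nP npos).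
Qed.

End FiniteCardinals.

Lemma has_card_choice {I : Type} (kappa : I -> cardinal) :
  (forall i, exists m, 0 < m /\ has_card (kappa i) m) ->
  exists n : I -> nat, (forall i, has_card (kappa i) (n i)) /\ (forall i, 0 < n i).
Proof. by move=> /choice[n nP]; exists n; split=> i; have [] := nP i. Qed.

(** No infinite term can dominate [C], as it would absorb it. Hence [C] is finite, being itself the
    size of a term, and then any infinite term would dominate it. *)
Lemma reversible_finite_cardinals {I : choiceType} (kappa : I -> cardinal)
    (C : cardinal) :
  (forall i, [set: kappa i] !=set0) ->
  reversible kappa -> infinite_set [set i | same_card (kappa i) C] ->
  forall i, exists m, 0 < m /\ has_card (kappa i) m.
Proof.
move=> kappa_neq0 rev Cinf i.
have key i0 : infinite_set [set: kappa i0] -> [set: C] #<= [set: kappa i0] -> False.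
  move=> inf0 C0; have [f [fs fi fsum]] := infinite_not_reversible _ _ _ inf0 C0 Cinf.
  apply: rev; exists f; split=> // l _; have [l' e] := fs l; by exists l'.
have Cfin : finite_set [set: C].
  apply: contrapT => inf; have [i1 i1C] := infinite_setN0 Cinf.
  apply: (key i1); first by rewrite (eq_finite_set i1C).
  by rewrite (card_le_eqr i1C).
have [m im] : finite_set [set: kappa i].
  apply: contrapT => inf; apply: (key i) => //.
  apply: card_le_trans (finite_set_countable Cfin) _; exact/infiniteP.
exists m; split=> //; rewrite lt0n; apply/eqP => m0.
move: im; rewrite m0 II0 card_eq0 => /eqP e.
by have [x] := kappa_neq0 i; rewrite e.
Qed.

Lemma reversibleP {I : choiceType} (kappa : I -> cardinal) :
  (forall i, [set: kappa i] !=set0) ->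
  reversible kappa <->
  (finite_to_one kappa \/
   [/\ forall i : I, exists m : nat, 0 < m /\ has_card (kappa i) m,
       repeated_values kappa !=set0,
       independent (repeated_values kappa)
     & finite_set [set m : nat | (exists i : I, has_card (kappa i) m) /\
                                 gcd_set (repeated_values kappa) %| m]]).
Proof.
move=> kappa_neq0; split=> [rev|].
  have [|/existsNP[C Cinf]] := pselect (finite_to_one kappa); first by left.
  right; have kfin := reversible_finite_cardinals _ _ kappa_neq0 rev Cinf.
  have [n [nP npos]] := has_card_choice _ kfin.
  have K0 : repeated_values kappa !=set0.
    have [i0 i0C] := infinite_setN0 Cinf.
    exists (n i0); split=> //; apply: contra_not Cinf => fin.
    apply: sub_finite_set fin => i /= iC; rewrite /has_card.
    by rewrite (card_eql iC) -(card_eql i0C); exact: nP.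
  split=> //; first exact: reversible_independent nP npos rev.
  exact: reversible_gcd nP npos rev K0.
case=> [fin|[kfin K0 ind fin]] [f [fs fi fsum]]; apply: fi.
  by apply: finite_to_one_injective fin _ fsum => l; have [i _] := fs l Logic.I; exists i.
have [n [nP npos]] := has_card_choice _ kfin.
have fs' l : exists i, f i = l by have [i _] := fs l Logic.I; exists i.
have fsum' : fiber_sums n f by exact/(sum_preserving_fiber_sums _ _ _ nP npos).
have KE := repeated_valuesE _ _ nP npos.
apply: (numeric_reversible n f npos fs' fsum' (gcd_set (repeated_values kappa))).
- by rewrite -KE.
- by rewrite -KE; have [] := gcd_setP (repeated_values kappa).
- apply: sub_finite_set fin => m [[i e] dm]; split=> //.
  by exists i; apply/(has_cardE _ _ nP).
Qed.

Theorem theorem1p1 (I : Type) (kappa : I -> cardinal)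
    (I_neq0 : [set: I] !=set0)
    (kappa_neq0 : forall i : I, [set: kappa i] !=set0) :
  reversible kappa <->
  (finite_to_one kappa \/
   [/\ forall i : I, exists m : nat, 0 < m /\ has_card (kappa i) m,
       repeated_values kappa !=set0,
       independent (repeated_values kappa)
     & finite_set [set m : nat | (exists i : I, has_card (kappa i) m) /\
                                 gcd_set (repeated_values kappa) %| m]]).
(* [{classic I}] gives [I] its classical choice structure. *)
Proof. exact: (@reversibleP {classic I} kappa kappa_neq0). Qed.
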